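(* Let $n, a \geq 1$ be integers and let $A, B \in \mathbb{C}^{n \times a}$ be nonzero matrices. Then we have the (rank $\leq 1$) lower bound $$A A^* \circ B B^* \ \geq \ \frac{1}{\min(\operatorname{rk}(A A^* ), \operatorname{rk}(B B^* ))} \cdot d_{A B^T}\, d_{A B^T}^*,$$ and the choice of constant is best possible.
   Context: For complex $m\times n$ matrices $X=(x_{jk})$, $Y=(y_{jk})$, the Schur (entrywise) product $X \circ Y$ is the $m\times n$ matrix with $(j,k)$ entry $x_{jk} y_{jk}$. For $n \times n$ complex matrices $X, Y$, $X \geq Y$ (Loewner ordering) means that $X - Y$ is positive semidefinite, i.e. Hermitian with non-negative eigenvalues. For a square matrix $M = (m_{jk}) \in \mathbb{C}^{n\times n}$, $d_M := (m_{11}, \dots, m_{nn})^T \in \mathbb{C}^n$ denotes the column vector of its diagonal entries. $X^T$ is the transpose (no conjugation) and $X^*$ the conjugate transpose; $\operatorname{rk}$ denotes rank. *)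

(* Defs.v *)
From mathcomp Require Import all_boot all_order all_algebra.
From mathcomp Require Export sesquilinear spectral complex reals.

Set Implicit Arguments.
Unset Strict Implicit.
Unset Printing Implicit Defensive.

Import Order.TTheory GRing.Theory Num.Theory.

Local Open Scope ring_scope.

Definition schurmx (C : numClosedFieldType) (m n : nat) (X Y : 'M[C]_(m, n)) :
  'M[C]_(m, n) := map2_mx *%R X Y.

(* In the partial order of C, 0 <= l says that l is real and non-negative.
   [eigenvalue] uses row eigenvectors, which gives the same spectrum. *)
Definition psdmx (C : numClosedFieldType) (n : nat) (M : 'M[C]_n) : Prop :=
  M \is hermsymmx /\ (forall l : C, eigenvalue M l -> 0 <= l).

Definition loewner_ge (C : numClosedFieldType) (n : nat) (X Y : 'M[C]_n) :
  Prop := psdmx (X - Y).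

Definition diagcol (C : numClosedFieldType) (n : nat) (M : 'M[C]_n) : 'cV[C]_n :=
  \col_i M i i.

(* Main.v *)
(** For a row vector [v] with [D = diag v] and [N = B^T D A], the quadratic form
    of the Schur product at [v] is the squared Frobenius norm [tr (N N^* )],
    while [v d = tr N].  Factoring [N = L V] with [V] having [rk N] orthonormal
    rows, Cauchy-Schwarz for [tr (L V)] gives [|tr N|^2 <= rk N * tr (N N^* )],
    and [rk N <= min (rk A) (rk B)].  For sharpness take [A] and [B] to be
    partial identity matrices: then [d^T] is an eigenvector of the difference,
    for the eigenvalue [1 - c * min r s]. *)
Require Import Defs.
From mathcomp Require Import all_boot all_order all_algebra.
From mathcomp Require Import sesquilinear spectral complex reals.

Import Order.TTheory GRing.Theory Num.Theory.

Local Open Scope ring_scope.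
Local Open Scope complex_scope.
Local Open Scope sesquilinear_scope.

Lemma trmxC_mul (C : numClosedFieldType) (m n p : nat)
  (A : 'M[C]_(m, n)) (B : 'M[C]_(n, p)) : (A *m B) ^t* = B ^t* *m A ^t*.
Proof. by rewrite trmx_mul map_mxM. Qed.

(** Identifies the Frobenius inner product with [dotmx] on vectorised matrices, so that
    Cauchy-Schwarz and positivity apply to traces. *)
Lemma dotmx_mxvec (C : numClosedFieldType) (m n : nat) (A B : 'M[C]_(m, n)) :
  dotmx (mxvec A) (mxvec B) = \tr (A *m B ^t*).
Proof.
rewrite dotmxE mxE (reindex _ (curry_mxvec_bij m n)) /=.
transitivity (\sum_i \sum_j A i j * Num.conj (B i j)).
  by rewrite pair_bigA; apply: eq_bigr => [[i j] _] /=; rewrite 2!mxE !mxvecE.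
by apply: eq_bigr => i _; rewrite mxE; apply: eq_bigr => j _; rewrite !mxE.
Qed.

Lemma mxrank_mul_trmxC (C : numClosedFieldType) (m n : nat) (A : 'M[C]_(m, n)) :
  \rank (A *m A ^t*) = \rank A.
Proof.
apply/eqP; rewrite eqn_leq mxrankM_maxl /=.
(* If u A A^* = 0, then u A has squared norm u A A^* u^* = 0; comparing kernel dimensions gives the
   missing rank inequality. *)
have: (kermx (A *m A ^t*) <= kermx A)%MS.
  apply/rV_subP => u /sub_kermxP uAA0; apply/sub_kermxP/eqP.
  suff : dotmx (u *m A) (u *m A) == 0 by rewrite dnorm_eq0.
  by rewrite dotmxE trmxC_mul mulmxA -(mulmxA u) uAA0 mul0mx mxE.
move/mxrankS; rewrite !mxrank_ker leq_sub2lE //; exact: rank_leq_row.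
Qed.

Lemma mxtrace_rank_bound (C : numClosedFieldType) (n : nat) (N : 'M[C]_n) :
  `|\tr N| ^+ 2 <= (\rank N)%:R * \tr (N *m N ^t*).
Proof.
pose V := schmidt (row_base N).
have V_unitary : V \is unitarymx by rewrite schmidt_unitarymx // rank_leq_col.
(* Orthonormalising the free family [row_base N] preserves its row space. *)
have /submxP[L NE] : (N <= V)%MS.
  by rewrite eqmx_schmidt_free ?eq_row_base ?row_base_free.
have VV1 := unitarymxP V_unitary.
have -> : \tr N = dotmx (mxvec L) (mxvec (V ^t*)).
  by rewrite dotmx_mxvec trmxCK -NE.
apply: (le_trans (CauchySchwarz _ _ _)).
rewrite /= !dotmx_mxvec trmxCK [\tr (V ^t* *m V)]mxtrace_mulC VV1 mxtrace1.
suff -> : N *m N ^t* = L *m L ^t* by rewrite mulrC.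
by rewrite {1 2}NE trmxC_mul !mulmxA mulmxtVK.
Qed.

Lemma hermsymmxP (C : numClosedFieldType) (n : nat) (M : 'M[C]_n) :
  reflect (M ^t* = M) (M \is hermsymmx).
Proof.
apply: (iffP (is_hermitianmxP _ _ _)); rewrite expr0 scale1r => h; exact: esym.
Qed.

(** On a row eigenvector v for l the form equals l times the squared norm of v, which is
    positive. *)
Lemma psdmx_of_form (C : numClosedFieldType) (n : nat) (M : 'M[C]_n) :
  M ^t* = M -> (forall v : 'rV_n, 0 <= (v *m M *m v ^t*) 0 0) -> psdmx M.
Proof.
move=> MH M_ge0; split; first exact/hermsymmxP.
move=> l /eigenvalueP[v vM v_neq0]; have := M_ge0 v.
rewrite vM -scalemxAl mxE -dotmxE pmulr_lge0 //; exact: dotmx_is_dotmx.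
Qed.

Lemma schur_form (C : numClosedFieldType) (n a : nat) (A B : 'M[C]_(n, a))
    (v : 'rV[C]_n) (N := B^T *m diag_mx v *m A) :
  (v *m schurmx (A *m A ^t*) (B *m B ^t*) *m v ^t*) 0 0 = \tr (N *m N ^t*).
Proof.
have -> : \tr (N *m N ^t*) =
    \tr (diag_mx v *m (A *m A ^t*) *m (diag_mx v) ^t* *m (B *m B ^t*)^T).
  rewrite /N !trmxC_mul -!mulmxA mxtrace_mulC -!mulmxA trmx_mul trmxK.
  by rewrite map_trmx trmxK.
rewrite /schurmx; set G := A *m _; set H := B *m _.
rewrite tr_diag_mx map_diag_mx mul_diag_mx mul_mx_diag mxE /mxtrace.
under eq_bigr => j _ do rewrite mxE mulr_suml.
rewrite exchange_big /=; apply: eq_bigr => i _.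
rewrite mxE; apply: eq_bigr => j _.
by rewrite !mxE mulrA mulrAC.
Qed.

Lemma diagcol_form (C : numClosedFieldType) (n a : nat) (A B : 'M[C]_(n, a))
    (v : 'rV[C]_n) :
  (v *m diagcol (A *m B^T)) 0 0 = \tr (B^T *m diag_mx v *m A).
Proof.
rewrite -mulmxA mxtrace_mulC -mulmxA mul_diag_mx mxE.
by apply: eq_bigr => i _; rewrite !mxE.
Qed.

Lemma schurmx_trmxC (C : numClosedFieldType) (m n : nat) (X Y : 'M[C]_(m, n)) :
  (schurmx X Y) ^t* = schurmx (X ^t*) (Y ^t*).
Proof. by apply/matrixP => i j; rewrite !mxE rmorphM. Qed.

Lemma schur_rank_bound (C : numClosedFieldType) (n a : nat) (A B : 'M[C]_(n, a))
    (d := diagcol (A *m B^T)) :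
  loewner_ge (schurmx (A *m A ^t*) (B *m B ^t*))
    ((minn (\rank (A *m A ^t*)) (\rank (B *m B ^t*)))%:R^-1 *: (d *m d ^t*)).
Proof.
set r := minn _ _; apply: psdmx_of_form => [|v].
  rewrite linearB linearZ /= map_mxB map_mxZ /= -/(_ ^t*) schurmx_trmxC.
  by rewrite !trmxC_mul !trmxCK fmorphV rmorph_nat.
rewrite mulmxBr mulmxBl mxE schur_form mxE; set N := B^T *m _ *m A.
have -> : v *m (r%:R^-1 *: (d *m d ^t*)) *m v ^t* =
    r%:R^-1 *: ((v *m d) *m (v *m d) ^t*).
  by rewrite -scalemxAr -scalemxAl trmxC_mul !mulmxA.
have -> : (r%:R^-1 *: ((v *m d) *m (v *m d) ^t*)) 0 0 = r%:R^-1 * `|\tr N| ^+ 2.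
  by rewrite mxE -diagcol_form normCK mxE big_ord1 !(mxE _ _ 0 0).
have rkN : (\rank N <= r)%N.
  rewrite leq_min !mxrank_mul_trmxC mxrankM_maxr /= -(mxrank_tr B).
  by rewrite (leq_trans (mxrankM_maxl _ _)) // mxrankM_maxl.
have NN_ge0 : 0 <= \tr (N *m N ^t*).
  by rewrite -dotmx_mxvec dnorm_ge0.
(* When r = 0, the convention 0^-1 = 0 makes the subtracted term vanish. *)
rewrite subr_ge0; case: (posnP r) => [->|r_gt0]; first by rewrite invr0 mul0r.
rewrite ler_pdivrMl ?ltr0n //; apply: (le_trans (mxtrace_rank_bound _ _ _)).
by rewrite ler_wpM2r ?ler_nat.
Qed.

Lemma schur_pid_mx (C : numClosedFieldType) (n r s : nat) :
  schurmx (pid_mx r : 'M[C]_n) (pid_mx s) = pid_mx (minn r s).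
Proof.
apply/matrixP => i j; rewrite !mxE leq_min -natrM mulnb.
by case: eqP => //=; case: (i < r)%N.
Qed.

(** Here d is the indicator of the first m coordinates: it is real, d^T d = m, and [pid_mx m] fixes
    d^T. *)
Lemma diagcol_pid_mx_eigen (C : numClosedFieldType) (n m : nat) (c : C)
    (d := diagcol (pid_mx m : 'M[C]_n)) : (m <= n)%N ->
  d^T *m (pid_mx m - c *: (d *m d ^t*)) = (1 - c * m%:R) *: d^T.
Proof.
move=> le_mn.
have dE : d ^t* = d^T.
  by apply/matrixP => i j; rewrite !mxE rmorph_nat.
have dd : d^T *m d = (m%:R)%:M.
  apply/matrixP => i j; rewrite !ord1 !mxE mulr1n.
  (* Write m as a sum of ones over ['I_m], then extend it to a conditional sum over ['I_n]. *)
  rewrite -[in RHS](card_ord m) -sumr_const (big_ord_widen _ (fun=> 1) le_mn).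
  rewrite [RHS]big_mkcond /=.
  by apply: eq_bigr => k _; rewrite !mxE eqxx /=; case: ifP; rewrite ?mulr1 ?mulr0.
have dpid : d^T *m pid_mx m = d^T.
  apply/matrixP => i j; rewrite !mxE (bigD1 j) //= !mxE eqxx /=.
  rewrite big1 => [|k /negPf k_neq]; last by rewrite !mxE -[(k : nat) == j]/(k == j) k_neq mulr0.
  by rewrite addr0; case: (j < m)%N; rewrite ?mulr1 ?mulr0.
rewrite mulmxBr dpid -scalemxAr dE mulmxA dd mul_scalar_mx scalerA.
by rewrite scalerBl scale1r.
Qed.

Theorem theorem1 (R : realType) (n a : nat) (n_ge1 : (1 <= n)%N) (a_ge1 : (1 <= a)%N) :
  (* the lower bound, and its rank *)
  (forall A B : 'M[R[i]]_(n, a), A != 0 -> B != 0 ->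
     let d := diagcol (A *m B^T) in
     loewner_ge (schurmx (A *m A ^t*) (B *m B ^t*))
       ((minn (\rank (A *m A ^t*)) (\rank (B *m B ^t*)))%:R^-1 *: (d *m d ^t*))
     /\ (\rank ((minn (\rank (A *m A ^t*)) (\rank (B *m B ^t*)))%:R^-1
                  *: (d *m d ^t*)) <= 1)%N)
  /\
  (* the constant is best possible, for every admissible pair of ranks *)
  (forall r s : nat, (1 <= r <= minn n a)%N -> (1 <= s <= minn n a)%N ->
     exists A B : 'M[R[i]]_(n, a),
       [/\ A != 0, B != 0, \rank (A *m A ^t*) = r, \rank (B *m B ^t*) = s &
         let d := diagcol (A *m B^T) in
         forall c : R[i],
           loewner_ge (schurmx (A *m A ^t*) (B *m B ^t*)) (c *: (d *m d ^t*)) ->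
           c <= (minn r s)%:R^-1]).
Proof.
split=> [A B A_neq0 B_neq0 d|r s /andP[r_gt0]].
  split; first exact: schur_rank_bound.
  by rewrite scalemxAl mulmx_max_rank.
rewrite leq_min => /andP[le_rn le_ra] /andP[s_gt0].
rewrite leq_min => /andP[le_sn le_sa].
have GE t : (t <= a)%N -> (pid_mx t : 'M[R[i]]_(n, a)) *m (pid_mx t) ^t* = pid_mx t.
  by move=> le_ta; rewrite tr_pid_mx map_pid_mx pid_mx_id.
have pid_neq0 t : (0 < t)%N -> (t <= n)%N -> (t <= a)%N ->
    (pid_mx t : 'M[R[i]]_(n, a)) != 0.
  by move=> t_gt0 tn ta; rewrite -mxrank_eq0 rank_pid_mx // -lt0n.
exists (pid_mx r), (pid_mx s); rewrite !GE //.
split; rewrite ?pid_neq0 ?rank_pid_mx // => d c [_ eig_ge0].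
have m_gt0 : (0 < minn r s)%N by rewrite leq_min r_gt0.
have dE : d = diagcol (pid_mx (minn r s)).
  by rewrite /d tr_pid_mx mul_pid_mx (minn_idPr _) // geq_min le_ra.
(* Clearing the denominator turns the bound on c into non-negativity of the eigenvalue 1 - c * min r
   s. *)
rewrite -(ler_pM2r (x := (minn r s)%:R)) ?ltr0n // mulVf ?pnatr_eq0 -?lt0n //.
rewrite -subr_ge0; apply: eig_ge0; apply/eigenvalueP; exists d^T.
  by rewrite schur_pid_mx dE diagcol_pid_mx_eigen // geq_min le_rn.
(* The eigenvector d^T is nonzero because its first entry is 1. *)
apply/eqP => /matrixP/(_ 0 (Ordinal n_ge1))/eqP.
by rewrite dE !mxE eqxx m_gt0 oner_eq0.
Qed.
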